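(* Let $k\ge1$ be an integer and let $f_{UB-D}:[1,\infty)\to\mathbb{R}$ be the piecewise-linear function with turning points given by $$f_{UB-D}(d)=\begin{cases}2k+1& d=1,\\ d\left(2k+1-\frac d2\right)& d=2,4,\dots,2k,\\ 2k^2+2k+1& d\ge 2k+1\end{cases}$$ (linear between consecutive points of $\{1,2,4,\dots,2k,2k+1\}$). For any real $(L,T)$ with $T>1$, $L\ge T-1$, satisfying $$N=(T-1)f_{UB-D}\Big(\frac{L}{T-1}\Big),$$ there exists a feasible pair $(L',T')$ for the D-CPPG such that $L-L'=O(km)$ and $T-T'=O(km)$, with absolute implied constants. Moreover, the curve $N=(T-1)f_{UB-D}\big(\frac{L}{T-1}\big)$ is, in the $(L,T-1)$ plane, the polyline connecting $$\Big(\tfrac{N}{f_{UB-D}(1)},\tfrac{N}{f_{UB-D}(1)}\Big)\to\Big(\tfrac{2N}{f_{UB-D}(2)},\tfrac{N}{f_{UB-D}(2)}\Big)\to\cdots\to\Big(\tfrac{2iN}{f_{UB-D}(2i)},\tfrac{N}{f_{UB-D}(2i)}\Big)\to\cdots\to\Big(\tfrac{2kN}{f_{UB-D}(2k)},\tfrac{N}{f_{UB-D}(2k)}\Big)\to\Big(\tfrac{(2k+1)N}{f_{UB-D}(2k+1)},\tfrac{N}{f_{UB-D}(2k+1)}\Big)\to\Big(\infty,\tfrac{N}{f_{UB-D}(2k+1)}\Big).$$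
   Context: Let $m\ge n\ge 1$ be integers, $N=mn$, $D=\{(x,y)\in\mathbb{R}^2: 0\le x\le n,\ 0\le y\le m\}$, $D_{int}=D\cap\mathbb{Z}^2$. Distances are $\ell_1$ distances. D-CPPG with integer coverage radius $k$: a covering path is a finite sequence $F_1,\dots,F_T$ of distinct points of $D_{int}$ (stops) such that every point of $D_{int}$ is within $\ell_1$ distance $k$ of some $F_i$; its stop count is $T$ and its path length is $\sum_{i=1}^{T-1}\|F_{i+1}-F_i\|_1$. A pair $(L,T)$ of real numbers is feasible if there is a covering path with stop count at most $T$ and path length at most $L$. The notation $A=O(km)$ means $|A|\le c\,km$ for a constant $c$. *)

(* Defs.v *)
From mathcomp Require Import all_boot all_order all_algebra.
From mathcomp Require Import boolp classical_sets set_interval reals.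

Set Implicit Arguments.
Unset Strict Implicit.
Unset Printing Implicit Defensive.

Import Order.TTheory GRing.Theory Num.Theory.
Local Open Scope ring_scope.
Local Open Scope classical_set_scope.

Definition in_Dint (m n : nat) (p : int * int) : bool :=
  (0 <= p.1 <= n%:Z) && (0 <= p.2 <= m%:Z).

Definition l1dist (p q : int * int) : int := `|p.1 - q.1| + `|p.2 - q.2|.

Definition covering_path (k m n : nat) (F : seq (int * int)) : Prop :=
  [/\ uniq F, all (in_Dint m n) F &
      forall p, in_Dint m n p -> exists2 q, q \in F & l1dist p q <= k%:Z].

(* Stops are indexed from 0, so the legs are i -> i + 1 for i < T - 1. *)
Definition path_length (F : seq (int * int)) : int :=
  \sum_(0 <= i < (size F).-1) l1dist (nth (0, 0) F i.+1) (nth (0, 0) F i).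

Definition feasible (R : realType) (k m n : nat) (L T : R) : Prop :=
  exists F, [/\ covering_path k m n F, (size F)%:R <= T
                & (path_length F)%:~R <= L].

(* The piecewise-linear function through the vertices p :: s, whose abscissae
   are meant to be increasing. It is constant to the right of the last vertex;
   to the left of the first one it takes junk values. *)
Fixpoint pwlinear (R : realType) (p : R * R) (s : seq (R * R)) (x : R) : R :=
  if s is q :: s' then
    if x <= q.1 then p.2 + (q.2 - p.2) / (q.1 - p.1) * (x - p.1)
    else pwlinear q s' x
  else p.2.

(* 2, 4, ..., 2k, 2k+1: the turning abscissae after 1. *)
Definition turns (k : nat) : seq nat :=
  [seq (2 * i)%N | i <- iota 1 k] ++ [:: (2 * k + 1)%N].

Definition turn_value (R : realType) (k d : nat) : R :=
  if d == 1%N then (2 * k + 1)%N%:R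
  else if (d <= 2 * k)%N then d%:R * ((2 * k + 1)%N%:R - d%:R / 2)
  else (2 * k ^ 2 + 2 * k + 1)%N%:R.

Definition fUBD (R : realType) (k : nat) (d : R) : R :=
  pwlinear (1, turn_value R k 1)
           [seq (e%:R, turn_value R k e) | e <- turns k] d.

(* The points (L, T - 1) of the curve. *)
Definition UBD_curve (R : realType) (k m n : nat) : set (R * R) :=
  [set p | exists L T : R,
     [/\ 1 < T, T - 1 <= L, (m * n)%N%:R = (T - 1) * fUBD k (L / (T - 1))
       & p = (L, T - 1)]].

Arguments UBD_curve : clear implicits.

Definition segment (R : realType) (p q : R * R) : set (R * R) :=
  [set (line_path p.1 q.1 t, line_path p.2 q.2 t) | t in `[0, 1]].

(* The polyline p -> s_1 -> ... -> s_r -> (oo, y), where y is the ordinate of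
   the last vertex s_r, so that its last piece is a horizontal ray. *)
Fixpoint polyline_to_infty (R : realType) (p : R * R) (s : seq (R * R)) :
    set (R * R) :=
  if s is q :: s' then segment p q `|` polyline_to_infty q s'
  else [set r | p.1 <= r.1 /\ r.2 = p.2].

Definition UBD_vertex (R : realType) (k m n d : nat) : R * R :=
  (d%:R * (m * n)%N%:R / fUBD k d%:R, (m * n)%N%:R / fUBD k d%:R).

(* Main.v *)
(* At a turning abscissa [d] of [fUBD], the bound is attained up to boundary
   effects by a periodic pattern of stops, visited along vertical lines, in
   which consecutive stops are at distance [d] and each stop accounts for
   [fUBD k d] points:
   - [d = 1]: full columns at distance [2k + 1];
   - [d = 2i]: columns at distance [2k + 1 - i] with one stop every [2i] points,
     consecutive columns being shifted by [i];
   - [d = 2k + 1]: the perfect code of radius [k], cut into vertical strips of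
     width [2k + 1], in each of which the code points form a single chain.
   Pushing the stops that lie outside a rectangle back to its boundary keeps the
   covering and does not lengthen the path. A point of the curve between two
   turning points is reached by using the two patterns side by side, the width
   of [D] being shared in the proportion of the points covered. *)

Require Import Defs.
From mathcomp Require Import all_boot all_order all_algebra.
From mathcomp Require Import boolp classical_sets set_interval reals.
From mathcomp Require Import zify ring lra.

Set Implicit Arguments.
Unset Strict Implicit.
Unset Printing Implicit Defensive.

Import Order.TTheory GRing.Theory Num.Theory.
Local Open Scope ring_scope.

(** * Lengths of walks *)

Lemma l1dist_triangle p q r : l1dist p r <= l1dist p q + l1dist q r.
Proof. rewrite /l1dist; lia. Qed.

Lemma l1distC p q : l1dist p q = l1dist q p.
Proof. by rewrite /l1dist distrC (distrC p.2). Qed.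

Lemma l1dist_ge0 p q : 0 <= l1dist p q.
Proof. by rewrite /l1dist addr_ge0. Qed.

Fixpoint walk_length (p : int * int) (F : seq (int * int)) : int :=
  if F is q :: F' then l1dist p q + walk_length q F' else 0.

Lemma path_length_cons p F : path_length (p :: F) = walk_length p F.
Proof.
rewrite /path_length /=; elim: F p => [|q F IH] p /=; first by rewrite big_geq.
by rewrite big_nat_recl //= l1distC IH.
Qed.

Lemma walk_length_ge0 p F : 0 <= walk_length p F.
Proof. by elim: F p => //= q F IH p; rewrite addr_ge0 ?l1dist_ge0. Qed.

Lemma walk_length_cat p F G :
  walk_length p (F ++ G) = walk_length p F + walk_length (last p F) G.
Proof. by elim: F p => [|q F IH] p /=; rewrite ?add0r // IH addrA. Qed.

Lemma walk_length_detour p q F :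
  walk_length p F <= l1dist p q + walk_length q F.
Proof.
case: F => [|r F] /=; first by rewrite addr0 l1dist_ge0.
by rewrite addrA lerD2r l1dist_triangle.
Qed.

Lemma walk_length_subseq p F G :
  subseq F G -> walk_length p F <= walk_length p G.
Proof.
elim: G F p => [|q G IH] [|r F] p //=; first by rewrite addr_ge0 ?l1dist_ge0 ?walk_length_ge0.
case: eqP => [->|_] sFG; first by rewrite lerD2l IH.
exact: le_trans (IH _ _ sFG) (walk_length_detour _ _ _).
Qed.

(** By the triangle inequality, deleting stops never lengthens a path. This is needed because
    clamping may merge stops and adjacent boxes overlap, while the stops of a covering path are
    distinct. *)
Lemma path_length_undup F : path_length (undup F) <= path_length F.
Proof.
have subl G H : subseq G H -> path_length G <= path_length H.
  case: G => [|p G]; case: H => [|q H]; rewrite ?path_length_cons //.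
    by rewrite {1}/path_length big_geq // walk_length_ge0.
  rewrite /=; case: eqP => [->|_] sub; first exact: walk_length_subseq.
  by have := walk_length_subseq q sub; apply: le_trans; rewrite /= lerDr l1dist_ge0.
exact/subl/undup_subseq.
Qed.

(** * Sweeping a grid of stops *)

Lemma last_map_iota (f : nat -> int * int) (B : nat) :
  last (f 0%N) [seq f j | j <- iota 1 B] = f B.
Proof. by case: B => // B; rewrite -[B.+1]addn1 iotaD map_cat last_cat /= add1n addn1. Qed.

Lemma walk_length_map (f : nat -> int * int) (B : nat) (d : int) :
  (forall j, (j < B)%N -> l1dist (f j) (f j.+1) <= d) ->
  walk_length (f 0%N) [seq f j | j <- iota 1 B] <= d *+ B.
Proof.
move=> step; suff: forall b, (b <= B)%N ->
    walk_length (f 0%N) [seq f j | j <- iota 1 b] <= d *+ b by apply.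
elim=> [|b IH] bB; first by rewrite mulr0n.
rewrite -[b.+1]addn1 iotaD map_cat walk_length_cat mulrnDr /= mulr1n addr0.
apply: lerD; first exact/IH/ltnW.
by rewrite add1n last_map_iota step.
Qed.

(* The rows are swept in boustrophedon order. *)
Lemma sweep (P : nat -> nat -> int * int) (A B : nat) (d e : int) :
  (forall r j, (j < B)%N -> l1dist (P r j) (P r j.+1) <= d) ->
  (forall r, l1dist (P r 0%N) (P r.+1 0%N) <= e) ->
  (forall r, l1dist (P r B) (P r.+1 B) <= e) ->
  exists G, [/\ forall p, p \in G <-> exists r j, [/\ (r <= A)%N, (j <= B)%N & p = P r j],
    size G = (A.+1 * B.+1)%N
    & path_length G <= d *+ (A.+1 * B) + e *+ A.+1].
Proof.
move=> step turn0 turnB.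
pose row (r : nat) (b : bool) j := P r (if b then B - j else j)%N.
pose rows r b := [seq row r b j | j <- iota 0 B.+1].
have e0 : 0 <= e by exact: le_trans (l1dist_ge0 _ _) (turn0 0%N).
have rowE r b : rows r b = row r b 0%N :: [seq row r b j | j <- iota 1 B] by [].
have row_len r b : walk_length (row r b 0%N) [seq row r b j | j <- iota 1 B] <= d *+ B.
  apply: walk_length_map => j jB; rewrite /row; case: b; last exact: step.
  rewrite l1distC -[(B - j)%N]prednK ?subn_gt0 // -subnS.
  by apply: step; rewrite subnS prednK ?subn_gt0 // leq_subr.
have in_rows r b p : p \in rows r b <-> exists2 j, (j <= B)%N & p = P r j.
  split=> [/mapP[j]|[j jB ->]].
    by rewrite mem_iota => jB ->; rewrite /row; case: b; [exists (B - j)%N|exists j] => //; lia.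
  apply/mapP; exists (if b then B - j else j)%N; first by rewrite mem_iota; case: (b); lia.
  by rewrite /row; case: b => //; rewrite subKn.
(* The induction on [A] also records in [b] whether the last row was traversed backwards, which
   decides at which end the next turn takes place. *)
have [g0 [G [b [inG sG lG _]]]] : exists g0 G, exists b : bool,
    [/\ forall p, p \in g0 :: G <->
           exists r j, [/\ (r <= A)%N, (j <= B)%N & p = P r j],
    size (g0 :: G) = (A.+1 * B.+1)%N,
    walk_length g0 G <= d *+ (A.+1 * B) + e *+ A.+1
    & last g0 G = P A (if b then 0 else B)%N].
  elim: A => [|A [g0 [G [b [inG sG lG lastG]]]]].
    exists (row 0%N false 0%N), [seq row 0%N false j | j <- iota 1 B], false; split.
    - move=> p; rewrite -rowE in_rows; split=> [[j jB ->]|[r [j [r0 jB ->]]]].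
        by exists 0%N, j.
      by exists j => //; move: r0; rewrite leqn0 => /eqP ->.
    - by rewrite /= size_map size_iota mul1n.
    - by rewrite mul1n mulr1n; apply: le_trans (row_len _ _) _; rewrite lerDl.
    - by rewrite last_map_iota.
  exists g0, (G ++ rows A.+1 (~~ b)), (~~ b); split.
  - move=> p; rewrite -cat_cons mem_cat; split=> [/orP[/inG[r [j [rA jB ->]]]|/in_rows[j jB ->]]|].
    + by exists r, j; rewrite (leq_trans rA).
    + by exists A.+1, j.
    + move=> [r [j [rA jB pE]]]; apply/orP.
      move: rA; rewrite leq_eqVlt => /orP[/eqP rA|rA].
        by right; apply/in_rows; exists j; rewrite // pE rA.
      by left; apply/inG; exists r, j.
  - by rewrite -cat_cons size_cat sG size_map size_iota (mulSn A.+1) addnC.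
  - rewrite walk_length_cat lastG rowE /= (mulSn A.+1) (mulrnDr d) (mulrSr e).
    have : l1dist (P A (if b then 0 else B)%N) (row A.+1 (~~ b) 0%N) <= e.
      by rewrite /row; case: (b) => //=; rewrite subn0.
    move: (row_len A.+1 (~~ b)) lG; lia.
  - rewrite rowE last_cat /= last_map_iota /row; case: (b) => //=; by rewrite subnn.
by exists (g0 :: G); split=> //; rewrite path_length_cons.
Qed.

(** * Boxes and clamped patterns *)

Definition in_box (a w m : nat) (p : int * int) : bool :=
  (a%:Z <= p.1 <= a%:Z + w%:Z) && (0 <= p.2 <= m%:Z).

Definition covers_box (k a w m : nat) (G : seq (int * int)) : Prop :=
  (forall p, p \in G -> in_box a w m p) /\
  (forall p, in_box a w m p -> exists2 q, q \in G & l1dist p q <= k%:Z).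

Definition clamp (b : nat) (x : int) : int :=
  if x <= 0 then 0 else if b%:Z <= x then b%:Z else x.

Lemma clamp_bounds b x : 0 <= clamp b x <= b%:Z.
Proof. by rewrite /clamp; case: ifP => [|?]; [|case: ifP => ?]; lia. Qed.

Lemma clamp_lipschitz b x y : `|clamp b x - clamp b y| <= `|x - y|.
Proof. by rewrite /clamp; do ! case: ifP => ?; lia. Qed.

Lemma clamp_id b x : 0 <= x <= b%:Z -> clamp b x = x.
Proof. by rewrite /clamp; do ! case: ifP => ?; lia. Qed.

Lemma clamp_le0 b x : x <= 0 -> clamp b x = 0.
Proof. by rewrite /clamp => ->. Qed.

Lemma clamp_ge b x : b%:Z <= x -> clamp b x = b%:Z.
Proof. by rewrite /clamp; do ! case: ifP => ?; lia. Qed.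

(* The stops of a pattern are pushed into the box by [clamp], which is
   1-Lipschitz and fixes the box: this costs neither coverage nor length. *)
Lemma clamped_sweep (k a w m A B d e : nat) (P : nat -> nat -> int * int) :
  (forall r j, (j < B)%N -> l1dist (P r j) (P r j.+1) <= d%:Z) ->
  (forall r, [/\ `|(P r.+1 0%N).1 - (P r 0%N).1| <= e%:Z,
     `|(P r.+1 B).1 - (P r B).1| <= e%:Z, (P r 0%N).2 <= 0 & m%:Z <= (P r B).2]) ->
  (forall x y : int, 0 <= x <= w%:Z -> 0 <= y <= m%:Z ->
     exists r j, [/\ (r <= A)%N, (j <= B)%N & l1dist (x, y) (P r j) <= k%:Z]) ->
  exists G, [/\ covers_box k a w m G, size G = (A.+1 * B.+1)%N
    & path_length G <= (d * (A.+1 * B.+1) + e * A.+1)%N%:Z].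
Proof.
move=> step turn cover.
pose Q r j : int * int := (a%:Z + clamp w (P r j).1, clamp m (P r j).2).
have dQ r j r' j' : l1dist (Q r j) (Q r' j') <= l1dist (P r j) (P r' j').
  rewrite /l1dist /=; move: (clamp_lipschitz w (P r j).1 (P r' j').1).
  by move: (clamp_lipschitz m (P r j).2 (P r' j').2); lia.
have step' r j : (j < B)%N -> l1dist (Q r j) (Q r j.+1) <= d%:Z.
  by move=> jB; apply: le_trans (dQ _ _ _ _) (step _ _ jB).
(* Every row starts at or below the bottom side and ends at or above the top side, so clamping gives
   the two ends of a turn the same ordinate: only the horizontal part is paid. *)
have turn0 r : l1dist (Q r 0%N) (Q r.+1 0%N) <= e%:Z.
  have [t _ b _] := turn r; have [_ _ b' _] := turn r.+1.
  rewrite /l1dist /= (clamp_le0 _ b) (clamp_le0 _ b').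
  by move: (clamp_lipschitz w (P r 0%N).1 (P r.+1 0%N).1); lia.
have turnB r : l1dist (Q r B) (Q r.+1 B) <= e%:Z.
  have [_ t _ b] := turn r; have [_ _ _ b'] := turn r.+1.
  rewrite /l1dist /= (clamp_ge b) (clamp_ge b').
  by move: (clamp_lipschitz w (P r B).1 (P r.+1 B).1); lia.
have [G [inG sG lG]] := sweep A step' turn0 turnB.
exists G; split=> //; last first.
  have mulrnE x n : x%:Z *+ n = (x * n)%N%:Z by rewrite -mulr_natr natz PoszM.
  apply: (le_trans lG); rewrite !mulrnE -PoszD lez_nat.
  by rewrite leq_add2r !leq_mul2l leqnSn !orbT.
split=> [p /inG[r [j [_ _ ->]]]|[x y] /andP[/= xin yin]].
  rewrite /in_box /= lerDl lerD2l.
  by move: (clamp_bounds w (P r j).1) (clamp_bounds m (P r j).2) => -> ->.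
have xin' : 0 <= x - a%:Z <= w%:Z by lia.
have [r [j [rA jB cov]]] := cover _ _ xin' yin.
exists (Q r j); first by apply/inG; exists r, j.
move: cov; rewrite /l1dist /=.
have := clamp_lipschitz w (x - a%:Z) (P r j).1; rewrite (clamp_id xin').
by have := clamp_lipschitz m y (P r j).2; rewrite (clamp_id yin); lia.
Qed.

(** * Full columns *)

Lemma columns_cover (k a w m : nat) :
  exists G A B, [/\ covers_box k a w m G, size G = (A.+1 * B.+1)%N,
    path_length G <= (1 * (A.+1 * B.+1) + (4 * k + 2) * A.+1)%N%:Z,
    (A * (2 * k + 1) <= w + 2 * (2 * k + 1))%N & (B <= m + 4)%N].
Proof.
(* Column [r] is the axis of the band of abscissae from [(2k + 1) r] to [(2k + 1) r + 2k]. The turn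
   cost [4k + 2] and the slack in the bounds on [A] and [B] are common to the three patterns, so
   that [grid_efficient] applies to each. *)
pose P r j : int * int := (((2 * k + 1) * r + k)%N%:Z, j%:Z).
have [|||G [cG sG lG]] := @clamped_sweep k a w m (w %/ (2 * k + 1)) m 1 (4 * k + 2) P.
- by move=> r j _; rewrite /l1dist /=; lia.
- by move=> r; rewrite /P /=; split; nia.
- move=> x y x_in y_in; exists (`|x| %/ (2 * k + 1))%N, `|y|%N; split; [|lia|].
    by rewrite leq_div2r //; lia.
  have := divn_eq `|x| (2 * k + 1).
  have : (`|x| %% (2 * k + 1) < 2 * k + 1)%N by rewrite ltn_mod; lia.
  by rewrite /l1dist /=; nia.
exists G, (w %/ (2 * k + 1))%N, m; split=> //; last lia.
by have := leq_trunc_div w (2 * k + 1); lia.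
Qed.

(** * Staggered columns *)

Definition staggered_stop (i s r j : nat) : int * int :=
  ((s * r)%N%:Z, (2 * i * j)%N%:Z - (2 * i)%N%:Z + (i * odd r)%N%:Z).

Lemma nat_of_int_divmod (x : int) (d : nat) : 0 <= x -> (0 < d)%N ->
  exists q u : nat, [/\ x = (d * q + u)%N%:Z, (u < d)%N &
    forall w : nat, x <= w%:Z -> (q <= w %/ d)%N].
Proof.
case: x => // x _ d0; exists (x %/ d)%N, (x %% d)%N; split.
- by rewrite mulnC -divn_eq.
- by rewrite ltn_mod.
- by move=> w xw; rewrite leq_div2r.
Qed.

(* The nearest stops of the two neighbouring columns are at vertical distances
   adding up to [i] and at horizontal distances adding up to [s = 2k + 1 - i]. *)
Lemma staggered_near (k i s r u c v : nat) :
  (s + i = 2 * k + 1)%N -> (u < s)%N -> (v < 2 * i)%N ->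
  exists r0 j0, [/\ (r0 <= r.+1)%N, (j0 <= c.+2)%N &
    l1dist ((s * r + u)%N%:Z, (2 * i * c + v)%N%:Z) (staggered_stop i s r0 j0) <= k%:Z].
Proof.
move=> sk us vi.
have near r0 j0 : (r0 <= r.+1)%N -> (j0 <= c.+2)%N ->
    `|(s * r)%N%:Z + u%:Z - (s * r0)%N%:Z| +
    `|(2 * i * c)%N%:Z + v%:Z - ((2 * i * j0)%N%:Z - (2 * i)%N%:Z + (i * odd r0)%N%:Z)| <= k%:Z ->
    exists r0 j0, [/\ (r0 <= r.+1)%N, (j0 <= c.+2)%N &
      l1dist ((s * r + u)%N%:Z, (2 * i * c + v)%N%:Z) (staggered_stop i s r0 j0) <= k%:Z].
  by move=> ? ? ?; exists r0, j0; rewrite /l1dist /= !PoszD.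
case: (leqP v i) => iv; case: (boolP (odd r)) => ro.
- case: (leqP (u + (i - v)) k) => uv;
  [apply: (near r c.+1)|apply: (near r.+1 c.+1)] => //;
  rewrite /= ro ?mulnS ?muln1 ?muln0;
  move: (2 * i * c)%N (s * r)%N => C S; lia.
- case: (leqP (u + v) k) => uv;
  [apply: (near r c.+1)|apply: (near r.+1 c.+1)] => //;
  rewrite /= (negbTE ro) ?mulnS ?muln1 ?muln0;
  move: (2 * i * c)%N (s * r)%N => C S; lia.
- case: (leqP (u + (v - i)) k) => uv; [apply: (near r c.+1)|apply: (near r.+1 c.+2)] => //;
  rewrite /= ro ?mulnS ?muln1 ?muln0;
  move: (2 * i * c)%N (s * r)%N => C S; lia.
- case: (leqP (u + (2 * i - v)) k) => uv; [apply: (near r c.+2)|apply: (near r.+1 c.+1)] => //;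
  rewrite /= (negbTE ro) ?mulnS ?muln1 ?muln0;
  move: (2 * i * c)%N (s * r)%N => C S; lia.
Qed.

Lemma staggered_cover (k i a w m : nat) : (0 < i)%N -> (i <= k)%N ->
  exists G A B, [/\ covers_box k a w m G, size G = (A.+1 * B.+1)%N,
    path_length G <= (2 * i * (A.+1 * B.+1) + (4 * k + 2) * A.+1)%N%:Z,
    (A * (2 * k + 1 - i) <= w + 2 * (2 * k + 1 - i))%N
    & (B * (2 * i) <= m + 4 * (2 * i))%N].
Proof.
move=> i0 ik.
have [s sk] : exists s, (s + i = 2 * k + 1)%N by exists (2 * k + 1 - i)%N; lia.
have -> : (2 * k + 1 - i)%N = s by lia.
have s0 : (0 < s)%N by lia.
have i20 : (0 < 2 * i)%N by lia.
have [B [Bm mB Bmax]] : exists B, [/\ (B * (2 * i) <= m)%N, (m <= 2 * i * B.+1)%N &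
    forall c, (c <= m %/ (2 * i))%N -> (c <= B)%N].
  by exists (m %/ (2 * i))%N; rewrite leq_trunc_div mulnC ltnW // ltn_ceil.
have [A [Aw Amax]] : exists A, (A * s <= w)%N /\
    forall c, (c <= w %/ s)%N -> (c <= A)%N.
  by exists (w %/ s)%N; rewrite leq_trunc_div.
have [|||G [cG sG lG]] :=
  @clamped_sweep k a w m A.+1 B.+2 (2 * i) (4 * k + 2) (staggered_stop i s).
- move=> r j _; rewrite /l1dist /= mulnS; lia.
(* The offset [- 2 i] puts the stop [j = 0] at or below the bottom side even in the columns shifted
   up by [i]; the stop [j = B.+2] is at or above the top side. *)
- move=> r; rewrite /staggered_stop; cbn [fst snd]; rewrite /= muln0 !mulnS.
  move: mB; rewrite mulnS; move: (2 * i * B)%N (s * r)%N => C S mB.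
  by split; case: (odd r); rewrite /= ?muln1 ?muln0; lia.
- move=> x y /andP[x0 xw] /andP[y0 ym].
  have [r [u [xE us /(_ _ xw)/Amax rA]]] := nat_of_int_divmod x0 s0.
  have [c [v [yE vi /(_ _ ym)/Bmax cB]]] := nat_of_int_divmod y0 i20.
  have [r0 [j0 [r0r j0c near]]] := staggered_near r c sk us vi.
  exists r0, j0; rewrite xE yE; split=> //.
    exact: leq_trans r0r _.
  exact: leq_trans j0c _.
exists G, A.+1, B.+2; split=> //; first by rewrite mulSn; lia.
by rewrite !mulSn; move: (B * (2 * i))%N Bm => C; lia.
Qed.

(** * The perfect code *)

Definition ball_card (k : nat) : nat := (2 * k ^ 2 + 2 * k + 1)%N.

Lemma ball_cardE k : (ball_card k)%:Z = (2 * k%:Z + 1) * k%:Z + k%:Z + 1.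
Proof. rewrite /ball_card -mulnn; lia. Qed.

(* The [ball_card k] points of the l1-ball represent all classes modulo
   [ball_card k] under [(a, b) |-> k a + (k + 1) b]. *)
Lemma ball_residue_nat (k r : nat) : (r <= k * k + k)%N ->
  exists a b : int, `|a| + `|b| <= k%:Z /\ k%:Z * a + (k%:Z + 1) * b = r%:Z.
Proof.
case: k => [|k'] rk; first by exists 0, 0; lia.
set k := k'.+1 in rk *.
have [w [b [rE bk]]] : exists w b, r = (w * k + b)%N /\ (b < k)%N.
  by exists (r %/ k)%N, (r %% k)%N; rewrite -divn_eq ltn_mod.
have wk : (w <= k.+1)%N.
  have : (w * k <= k.+1 * k)%N by rewrite mulSn; lia.
  by rewrite leq_pmul2r.
have [wE|wk'] := eqVneq w k.+1.
  exists 0, k%:Z; split; first by [].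
  by move: rk; rewrite rE wE mulSn; lia.
(* The pair [(w - b, b)] has value [r] and norm [w] if [b <= w], else [2 b - w]. If the latter
   exceeds [k], adding [(k + 1, - k)], on which the form vanishes, brings the norm down to
   [w + 1 + 2 k - 2 b <= k]. *)
case: (leqP b w) => bw.
  by exists (w%:Z - b%:Z), b%:Z; rewrite rE; split; [lia|rewrite PoszD PoszM; ring].
case: (leqP (2 * b - w) k) => bw'.
  by exists (w%:Z - b%:Z), b%:Z; rewrite rE; split; [lia|rewrite PoszD PoszM; ring].
exists (w%:Z + 1 - b%:Z + k%:Z), (b%:Z - k%:Z); rewrite rE; split; first lia.
by rewrite PoszD PoszM; ring.
Qed.

(** As [ball_card k = 2 (k^2 + k) + 1], the balanced remainder of [z] is at most [k^2 + k] in
    absolute value, and the ball is symmetric about the origin. *)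
Lemma ball_residue (k : nat) (z : int) : exists a b c : int,
  `|a| + `|b| <= k%:Z /\ k%:Z * a + (k%:Z + 1) * b = z - (ball_card k)%:Z * c.
Proof.
have q0 : 0 < (ball_card k)%:Z by rewrite /ball_card; lia.
have qE : (ball_card k)%:Z = 2 * (k * k + k)%N%:Z + 1.
  by rewrite /ball_card -mulnn; lia.
pose c := ((z + (k * k + k)%N%:Z) %/ (ball_card k)%:Z)%Z.
have zE := divz_eq (z + (k * k + k)%N%:Z) (ball_card k)%:Z.
have u0 := modz_ge0 (z + (k * k + k)%N%:Z) (lt0r_neq0 q0).
have uq := ltz_pmod (z + (k * k + k)%N%:Z) q0.
move: (modz _ _) u0 uq zE => u u0 uq; rewrite -/c => zE.
have {zE} zE : z - (ball_card k)%:Z * c = u - (k * k + k)%N%:Z by rewrite mulrC; lia.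
case: (lerP 0 (u - (k * k + k)%N%:Z)) => r0.
  have [|a [b [abk abE]]] := @ball_residue_nat k `|u - (k * k + k)%N%:Z|; first lia.
  by exists a, b, c; rewrite abE zE; split=> //; lia.
have [|a [b [abk abE]]] := @ball_residue_nat k `|u - (k * k + k)%N%:Z|; first lia.
exists (- a), (- b), c; rewrite zE; split; first lia.
by rewrite !mulrN -opprD abE; lia.
Qed.

(* The code [{(x, y) | (k + 1) x + k y = 0 mod ball_card k}], whose l1-balls of
   radius [k] tile the plane. Its points in the vertical strip
   [(2k + 1) r <= x < (2k + 1) (r + 1)] form a single chain indexed by [j],
   with steps [(k + 1, k)] and [(- k, k + 1)]. *)
Definition strip_stop (k : nat) (r j : int) : int * int :=
  ((2 * k%:Z + 1) * r + (((k%:Z + 1) * j) %% (2 * k%:Z + 1))%Z,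
   k%:Z * j + (((k%:Z + 1) * j) %/ (2 * k%:Z + 1))%Z - r).

Lemma strip_stopP k r j : exists Q u : int,
  [/\ strip_stop k r j = ((2 * k%:Z + 1) * r + u, k%:Z * j + Q - r),
      (k%:Z + 1) * j = Q * (2 * k%:Z + 1) + u & 0 <= u < 2 * k%:Z + 1].
Proof.
have K0 : 0 < 2 * k%:Z + 1 by lia.
exists (((k%:Z + 1) * j) %/ (2 * k%:Z + 1))%Z, (((k%:Z + 1) * j) %% (2 * k%:Z + 1))%Z.
by rewrite -divz_eq modz_ge0 ?ltz_pmod ?lt0r_neq0.
Qed.

Lemma euclid_unique (d q q' u u' : int) :
  q * d + u = q' * d + u' -> 0 <= u < d -> 0 <= u' < d -> q = q'.
Proof.
move=> E ud ud'; have d0 : d != 0 by lia.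
have := congr1 (divz^~ d) E.
by rewrite /= !divzMDl // !divz_small ?addr0 //; lia.
Qed.

Lemma strip_stop_step k r j :
  l1dist (strip_stop k r j) (strip_stop k r (j + 1)) <= (2 * k + 1)%N%:Z.
Proof.
have [Q [u [-> E /andP[u0 u1]]]] := strip_stopP k r j.
have [Q' [u' [-> E' /andP[u0' u1']]]] := strip_stopP k r (j + 1).
have {}E' : (Q' - Q) * (2 * k%:Z + 1) = u - u' + k%:Z + 1.
  rewrite mulrBl; move: E E'; rewrite mulrDr mulr1; lia.
have : Q' - Q = 0 \/ Q' - Q = 1.
  move: E'; set D := Q' - Q => E'.
  case: (lerP D (-1)) => D1; first nia.
  case: (lerP 2 D) => D2; first nia.
  lia.
rewrite /l1dist /= mulrDr mulr1; move: (k%:Z * j) ((2 * k%:Z + 1) * r) => X Y.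
by case=> DE; rewrite DE ?mul0r ?mul1r in E'; lia.
Qed.

(** The ordinate plus [r] is the integer part of [ball_card k * j / (2k + 1)]. Hence a chain climbs
    [ball_card k / (2k + 1)] per stop on average, and heights translate into ranges of indices. *)
Lemma strip_stop_height k r j (y := (strip_stop k r j).2) :
  (2 * k%:Z + 1) * (y + r) <= (ball_card k)%:Z * j < (2 * k%:Z + 1) * (y + r + 1).
Proof.
rewrite /y; have [Q [u [-> E u01]]] := strip_stopP k r j => /=.
have -> : (ball_card k)%:Z * j = (2 * k%:Z + 1) * k%:Z * j + (k%:Z + 1) * j.
  by rewrite ball_cardE; ring.
have -> : (2 * k%:Z + 1) * (k%:Z * j + Q - r + r) =
    (2 * k%:Z + 1) * k%:Z * j + Q * (2 * k%:Z + 1) by ring.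
have -> : (2 * k%:Z + 1) * (k%:Z * j + Q - r + r + 1) =
    (2 * k%:Z + 1) * k%:Z * j + (Q * (2 * k%:Z + 1) + (2 * k%:Z + 1))
    by ring.
by rewrite lerD2l ltrD2l E lerDl ltrD2l.
Qed.

(** Subtracting from [p] the ball point with the same residue gives a code point; it remains to find
    its strip and its index in the chain. *)
Lemma strip_stop_near k (p : int * int) :
  exists r j, l1dist p (strip_stop k r j) <= k%:Z.
Proof.
case: p => X Y; have [b [a [c [abk abE]]]] := ball_residue k (k%:Z * Y + (k%:Z + 1) * X).
have K0 : 0 < 2 * k%:Z + 1 by lia.
pose x : int := X - a; pose y : int := Y - b.
have xyE : k%:Z * y + (k%:Z + 1) * x = (ball_card k)%:Z * c.
  have -> : k%:Z * y + (k%:Z + 1) * x =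
    (k%:Z * Y + (k%:Z + 1) * X) - (k%:Z * b + (k%:Z + 1) * a) by rewrite /x /y; ring.
  by rewrite abE; ring.
(* At [strip_stop k r j] the form equals [ball_card k * (r + j - Q)], where [Q] is the quotient of
   [(k + 1) j] by [2k + 1]. So [c = r + j - Q], and solving for the index gives this [j]. *)
pose j : int := x + y - 2 * k%:Z * c; pose r : int := (x %/ (2 * k%:Z + 1))%Z.
have xE := divz_eq x (2 * k%:Z + 1); rewrite -/r in xE.
have jE : (k%:Z + 1) * j = (r + (j - c)) * (2 * k%:Z + 1) + (x %% (2 * k%:Z + 1))%Z.
  have -> : (r + (j - c)) * (2 * k%:Z + 1) + (x %% (2 * k%:Z + 1))%Z =
    x + (j - c) * (2 * k%:Z + 1) by rewrite {2}xE; ring.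
  have -> : x + (j - c) * (2 * k%:Z + 1) = (k%:Z + 1) * j +
     (x + k%:Z * (x + y - 2 * k%:Z * c) - c * (2 * k%:Z + 1)) by rewrite /j; ring.
  have -> : x + k%:Z * (x + y - 2 * k%:Z * c) - c * (2 * k%:Z + 1) =
     k%:Z * y + (k%:Z + 1) * x - ((2 * k%:Z + 1) * k%:Z + k%:Z + 1) * c by ring.
  by rewrite xyE ball_cardE subrr addr0.
have yE : y = k%:Z * j + (r + (j - c)) - r.
  have -> : k%:Z * j + (r + (j - c)) - r =
    y + ((k%:Z * y + (k%:Z + 1) * x) - ((2 * k%:Z + 1) * k%:Z + k%:Z + 1) * c)
    by rewrite /j; ring.
  by rewrite xyE ball_cardE subrr addr0.
have [Q [u [sE uE u01]]] := strip_stopP k r j.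
have u01' : 0 <= (x %% (2 * k%:Z + 1))%Z < 2 * k%:Z + 1.
  by rewrite modz_ge0 ?ltz_pmod ?lt0r_neq0.
have QE : Q = r + (j - c).
  by apply: (euclid_unique _ u01 u01'); rewrite -uE.
exists r, j; rewrite sE QE -yE /l1dist /=.
have -> : u = (x %% (2 * k%:Z + 1))%Z by move: jE; rewrite uE QE; lia.
by rewrite mulrC -xE /x /y; lia.
Qed.

Lemma perfect_cover (k a w m : nat) :
  exists G A B, [/\ covers_box k a w m G, size G = (A.+1 * B.+1)%N,
    path_length G <= ((2 * k + 1) * (A.+1 * B.+1) + (4 * k + 2) * A.+1)%N%:Z,
    (A * (2 * k + 1) <= w + 2 * (2 * k + 1))%N
    & (B * ball_card k <= m * (2 * k + 1) + 4 * ball_card k)%N].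
Proof.
have K0 : 0 < 2 * k%:Z + 1 by lia.
have q0 : 0 < (ball_card k)%:Z by rewrite /ball_card; lia.
(* The chains must extend over a height of [m + 2k + 1]; by this inequality the excess over [m]
   costs at most two more stops per strip. *)
have KK : ((2 * k + 1) * (2 * k + 1) <= 2 * ball_card k)%N by rewrite /ball_card -mulnn; lia.
pose K := (2 * k + 1)%N; have KE : 2 * k%:Z + 1 = K%:Z by rewrite /K; lia.
have [B [Bm mB]] : exists B, (B * ball_card k <= (2 * k + 1) * (m + 2 * k + 1))%N /\
    ((2 * k + 1) * (m + 2 * k + 1) <= ball_card k * B.+1)%N.
  exists ((2 * k + 1) * (m + 2 * k + 1) %/ ball_card k)%N.
  by rewrite leq_trunc_div [X in (_ <= X)%N]mulnC ltnW // ltn_ceil.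
have [A [Aw wA]] : exists A, (A * (2 * k + 1) <= w + k)%N /\
    (w + k < (2 * k + 1) * A.+1)%N.
  by exists ((w + k) %/ (2 * k + 1))%N; rewrite leq_trunc_div [X in (_ < X)%N]mulnC
    ltn_ceil ?addn1.
(* The stop [J r] of strip [r] has height at most [- k], and [B.+2] steps later the height exceeds
   [m + k]: every stop of the strip within distance [k] of the box has its index in this window. *)
pose J (r : int) : int := (((2 * k%:Z + 1) * (r - k%:Z)) %/ (ball_card k)%:Z)%Z.
have JP r :
    (ball_card k)%:Z * J r <= (2 * k%:Z + 1) * (r - k%:Z) < (ball_card k)%:Z * (J r + 1).
  rewrite (divz_eq ((2 * k%:Z + 1) * (r - k%:Z)) (ball_card k)%:Z) -/(J r).
  rewrite [J r * _]mulrC lerDl modz_ge0 ?lt0r_neq0 //=.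
  by rewrite [_ * (J r + 1)]mulrDr mulr1 ltrD2l ltz_pmod.
have JB r : (2 * k%:Z + 1) * (m%:Z + k%:Z + r + 1) <= (ball_card k)%:Z * (J r + B.+2%:Z).
  have /andP[_ /ltW J1] := JP r.
  have -> : (2 * k%:Z + 1) * (m%:Z + k%:Z + r + 1) =
    (2 * k%:Z + 1) * (r - k%:Z) + ((2 * k + 1) * (m + 2 * k + 1))%N%:Z.
    by rewrite !PoszM !PoszD; ring.
  have -> : (ball_card k)%:Z * (J r + B.+2%:Z) =
      (ball_card k)%:Z * (J r + 1) + (ball_card k * B.+1)%N%:Z.
    by rewrite PoszM -[B.+2]addn1 PoszD; ring.
  by rewrite lerD // lez_nat.
(* A stop that serves the box may lie up to [k] to its left, in strip [-1]; hence the shift of [r]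
   by one. *)
pose P r j : int * int := strip_stop k (r%:Z - 1) (J (r%:Z - 1) + j%:Z).
(* Abscissae within a strip vary by at most [2k], so a turn between neighbouring strips costs at
   most [(2k + 1) + 2k], within the allowed [4k + 2]. *)
have strip_x r r' j j' :
    (strip_stop k r j).1 - (strip_stop k r' j').1 - (2 * k%:Z + 1) * (r - r') <=
      2 * k%:Z /\
    - (2 * k%:Z) <= (strip_stop k r j).1 - (strip_stop k r' j').1 - (2 * k%:Z + 1) * (r - r').
  have [Q [u [-> _ u01]]] := strip_stopP k r j.
  have [Q' [u' [-> _ u01']]] := strip_stopP k r' j' => /=; rewrite mulrBr; split; lia.
have [|||G [cG sG lG]] := @clamped_sweep k a w m A.+1 B.+2 (2 * k + 1) (4 * k + 2) P.
- by move=> r j _; rewrite /P -[j.+1]addn1 PoszD addrA strip_stop_step.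
- have dr r : r.+1%:Z - 1 - (r%:Z - 1) = 1 :> int by lia.
  move=> r; split.
  + rewrite /P; move: (strip_x (r.+1%:Z - 1) (r%:Z - 1)
      (J (r.+1%:Z - 1) + 0%:Z) (J (r%:Z - 1) + 0%:Z)).
    by rewrite dr mulr1; lia.
  + rewrite /P; move: (strip_x (r.+1%:Z - 1) (r%:Z - 1)
      (J (r.+1%:Z - 1) + B.+2%:Z) (J (r%:Z - 1) + B.+2%:Z)).
    by rewrite dr mulr1; lia.
  + rewrite /P; move: (r%:Z - 1) => s; rewrite addr0.
    have /andP[h _] := strip_stop_height k s (J s); have /andP[/(le_trans h) + _] := JP s.
    by rewrite ler_pM2l //; lia.
  + rewrite /P; move: (r%:Z - 1) => s.
    have /andP[_ h] := strip_stop_height k s (J s + B.+2%:Z).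
    by have := le_lt_trans (JB s) h; rewrite ltr_pM2l //; lia.
- move=> x y xw ym; have [r [j near]] := strip_stop_near k (x, y).
  have [rlo rhi] : -1 <= r /\ r <= A%:Z.
    move: near; rewrite /l1dist; have [Q [u [-> _ u01]]] := strip_stopP k r j => /= near.
    split.
      have : (2 * k%:Z + 1) * (-2) < (2 * k%:Z + 1) * r by rewrite mulrN; lia.
      by rewrite ltr_pM2l //; lia.
    have : (2 * k%:Z + 1) * r < (2 * k%:Z + 1) * A.+1%:Z.
      have : (w + k)%N%:Z < ((2 * k + 1) * A.+1)%N%:Z by rewrite ltz_nat.
      by rewrite PoszM -/K -KE; lia.
    by rewrite ltr_pM2l //; lia.
  have /andP[h1 h2] := strip_stop_height k r j.
  have /andP[J1 J2] := JP r.
  have jlo : J r <= j.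
    have h : (2 * k%:Z + 1) * (r - k%:Z) <= (2 * k%:Z + 1) * ((strip_stop k r j).2 + r).
      by rewrite ler_pM2l //; move: near; rewrite /l1dist /=; lia.
    by have := le_trans (le_trans J1 h) h1; rewrite ler_pM2l.
  have jhi : j <= J r + B.+2%:Z.
    have h : (2 * k%:Z + 1) * ((strip_stop k r j).2 + r + 1) <=
        (2 * k%:Z + 1) * (m%:Z + k%:Z + r + 1).
      by rewrite ler_pM2l //; move: near; rewrite /l1dist /=; lia.
    by have := le_trans (ltW h2) (le_trans h (JB r)); rewrite ler_pM2l.
  exists (absz (r + 1)), (absz (j - J r)); split; [lia|lia|].
  rewrite /P; have -> : (absz (r + 1))%:Z - 1 = r by lia.
  by have -> : J r + (absz (j - J r))%:Z = j by lia.
exists G, A.+1, B.+2; split=> //; first by rewrite mulSn; lia.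
by rewrite !mulSn; move: Bm; rewrite -addnA mulnDr; move: (B * ball_card k)%N => C; lia.
Qed.

(** * Efficiency of a pattern with legs [u.1] and [u.2] points per stop *)

Definition efficient (R : realType) (k : nat) (u : R * R) : Prop :=
  forall a w m : nat, (w <= m)%N -> (0 < m)%N -> exists G,
    [/\ covers_box k a w m G,
        (size G)%:R <= w%:R * m%:R / u.2 + 23 * m%:R
      & (path_length G)%:~R <= u.1 * (w%:R * m%:R / u.2) + 100 * (k * m)%N%:R].

(** With columns at distance [s] and one stop per height [h], the box needs about [(w / s) (m / h)]
    stops; the extra rows and columns cost [O(m)] stops because [w <= m]. The parameter [h] is real
    since for the perfect code it is an average. *)
Lemma grid_efficient (R : realType) (k d : nat) (s h : R) :
  (0 < k)%N -> (d <= 2 * k + 1)%N -> 1 <= s -> 1 <= h ->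
  (forall a w m : nat, exists G A B, [/\ covers_box k a w m G, size G = (A.+1 * B.+1)%N,
    path_length G <= (d * (A.+1 * B.+1) + (4 * k + 2) * A.+1)%N%:Z,
    A%:R * s <= w%:R + 2 * s & B%:R * h <= m%:R + 4 * h]) ->
  efficient k (d%:R, s * h).
Proof.
move=> k0 dk s1 h1 grid a w m wm m0 /=; have [G [A [B [cG sG lG As Bh]]]] := grid a w m.
have s0 : 0 < s by apply: lt_le_trans s1. have h0 : 0 < h by apply: lt_le_trans h1.
set x := w%:R / s; set y := m%:R / h.
have xw : x <= w%:R by rewrite ler_pdivrMr // ler_peMr.
have ym : y <= m%:R by rewrite ler_pdivrMr // ler_peMr.
have wmR : w%:R <= m%:R :> R by rewrite ler_nat.
have x0 : 0 <= x by rewrite divr_ge0 // ltW.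
have y0 : 0 <= y by rewrite divr_ge0 // ltW.
have Ax : A%:R + 1 <= x + 3.
  have : A%:R <= (w%:R + 2 * s) / s by rewrite ler_pdivlMr.
  by rewrite mulrDl mulfK ?gt_eqF // -/x; lra.
have By : B%:R + 1 <= y + 5.
  have : B%:R <= (m%:R + 4 * h) / h by rewrite ler_pdivlMr.
  by rewrite mulrDl mulfK ?gt_eqF // -/y; lra.
have k1 : 1 <= k%:R :> R by rewrite ler1n.
have m1 : 1 <= m%:R :> R by rewrite ler1n.
have dkR : d%:R <= 2 * k%:R + 1 :> R by rewrite -natrM natr1 ler_nat -addn1.
(* The excess [5 x + 3 y + 15] of the product is at most [23 m], since [x], [y] and [1] are at most
   [m]. *)
have size_le : (A.+1 * B.+1)%N%:R <= x * y + 23 * m%:R :> R.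
  rewrite natrM -!natr1; apply: (@le_trans _ _ ((x + 3) * (y + 5))).
    by rewrite ler_pM ?addr_ge0 ?ler0n.
  by rewrite !(mulrDl, mulrDr); lra.
have -> : w%:R * m%:R / (s * h) = x * y by rewrite /x /y; field; rewrite !gt_eqF.
exists G; split=> //; first by rewrite sG.
have /le_trans -> // : (path_length G)%:~R <=
    (d%:R * (A.+1 * B.+1)%:R + (4 * k%:R + 2) * (A%:R + 1)) :> R.
  apply: (@le_trans _ _ (d * (A.+1 * B.+1) + (4 * k + 2) * A.+1)%N%:Z%:~R).
    by rewrite ler_int.
  by rewrite -pmulrn natr1 -2!natrM -natrD -natrM -natrD.
(* The error terms are at most [69 k m], from [d <= 2k + 1], and [24 k m]. *)
apply: (@le_trans _ _ (d%:R * (x * y + 23 * m%:R) + (4 * k%:R + 2) * (m%:R + 3))).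
  rewrite lerD //; first by rewrite ler_wpM2l.
  by rewrite ler_wpM2l //; lra.
have dm : d%:R * m%:R <= (2 * k%:R + 1) * m%:R :> R by rewrite ler_wpM2r.
have km_m : m%:R <= k%:R * m%:R :> R by rewrite ler_peMl.
have km_k : k%:R <= k%:R * m%:R :> R by rewrite ler_peMr.
by rewrite natrM !(mulrDl, mulrDr) in dm *; lra.
Qed.

(** * Efficiency at the turning points *)

Lemma mem_turns k d : (0 < k)%N -> d \in 1%N :: turns k ->
  [\/ d = 1%N, exists2 i, (0 < i <= k)%N & d = (2 * i)%N | d = (2 * k + 1)%N].
Proof.
move=> k0; rewrite inE mem_cat => /orP[/eqP ->|/orP[/mapP[i]|]]; first by constructor 1.
  by rewrite mem_iota => ik ->; constructor 2; exists i => //; lia.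
by rewrite inE => /eqP ->; constructor 3.
Qed.

(** In this form the value is the area of a cell: the distance of the columns times the distance of
    the stops in a column. *)
Lemma turn_value_even (R : realType) k i : (i <= k)%N ->
  turn_value R k (2 * i) = (2 * k + 1 - i)%N%:R * (2 * i)%N%:R.
Proof.
move=> ik; rewrite /turn_value ifF; last by apply/eqP; lia.
rewrite leq_mul2l ik orbT mulrC natrB; last lia.
by congr (_ * _); congr (_ - _); rewrite [X in X / _]natrM; field.
Qed.

Lemma turn_value_last (R : realType) k : (0 < k)%N ->
  turn_value R k (2 * k + 1) = (ball_card k)%:R.
Proof. by move=> k0; rewrite /turn_value ifF ?ifF //; lia. Qed.

Lemma turn_efficient (R : realType) k d : (0 < k)%N -> d \in 1%N :: turns k ->
  efficient k (d%:R : R, turn_value R k d).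
Proof.
move=> k0 /(mem_turns k0)[->|[i /andP[i0 ik] ->]|->].
- have -> : turn_value R k 1 = (2 * k + 1)%:R * 1 by rewrite mulr1.
  apply: grid_efficient; rewrite ?ler1n ?addn1 //.
  move=> a w m; have [G [A [B [cG sG lG Aw Bm]]]] := columns_cover k a w m.
  exists G, A, B; split=> //; first by rewrite -natrM -[2]/(2%:R) -natrM -natrD ler_nat -addn1.
  by rewrite !mulr1 -natrD ler_nat.
- rewrite turn_value_even //; apply: grid_efficient; rewrite ?ler1n //; try lia.
  move=> a w m; have [G [A [B [cG sG lG Aw Bm]]]] := staggered_cover a w m i0 ik.
  exists G, A, B; split=> //.
    by rewrite -natrM -[2]/(2%:R) -natrM -natrD ler_nat.
  by rewrite -natrM -[4]/(4%:R) -natrM -natrD ler_nat.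
- rewrite turn_value_last //.
  have K0 : 0 < (2 * k + 1)%:R :> R by rewrite ltr0n addn1.
  (* The second factor is the mean climb per stop of a chain in a strip of width [2k + 1]. *)
  have -> : (ball_card k)%:R = (2 * k + 1)%:R * ((ball_card k)%:R / (2 * k + 1)%:R) :> R.
    by rewrite mulrC mulfVK ?gt_eqF.
  apply: grid_efficient => //; first by rewrite ler1n addn1.
    by rewrite ler_pdivlMr // mul1r ler_nat /ball_card; nia.
  move=> a w m; have [G [A [B [cG sG lG Aw Bm]]]] := perfect_cover k a w m.
  exists G, A, B; split=> //.
    by rewrite -natrM -[2]/(2%:R) -natrM -natrD ler_nat.
  rewrite -(ler_pM2r K0) mulrDl -!mulrA !mulVf ?gt_eqF // !mulr1.
  by rewrite -[4]/(4%:R) -!natrM -natrD ler_nat.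
Qed.

(** * Two patterns side by side *)

Lemma path_length_cat_le (m n : nat) F G :
  all (in_Dint m n) F -> all (in_Dint m n) G ->
  path_length (F ++ G) <= path_length F + path_length G + (m + n)%N%:Z.
Proof.
have nil0 : path_length [::] = 0 by rewrite /path_length big_geq.
case: F => [|p F]; case: G => [|q G]; rewrite ?cats0 ?nil0 ?cat_cons ?path_length_cons;
  try lia.
rewrite walk_length_cat /= -/(all _ (p :: F)) => DF /andP[Dq _].
have Dl : in_Dint m n (last p F) by apply: (allP DF); rewrite mem_last.
have : l1dist (last p F) q <= (m + n)%N%:Z.
  by move: Dl Dq; rewrite /in_Dint /l1dist; lia.
lia.
Qed.

Lemma in_box_Dint a w m n p : (a + w <= n)%N -> in_box a w m p -> in_Dint m n p.
Proof. rewrite /in_box /in_Dint; lia. Qed.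

Lemma in_Dint_boxes a m n p : (a <= n)%N ->
  in_Dint m n p -> in_box 0 a m p || in_box a (n - a) m p.
Proof. rewrite /in_box /in_Dint; lia. Qed.

Lemma efficient_mixture (R : realType) (k m n : nat) (u v : R * R) (t mu : R) :
  (0 < k)%N -> (n <= m)%N -> (0 < m)%N -> 0 <= mu <= 1 -> 0 < t ->
  efficient k u -> efficient k v ->
  0 < u.2 -> 0 <= u.1 -> 1 <= v.2 -> 0 <= v.1 <= v.2 ->
  (m * n)%N%:R = t * ((1 - mu) * u.2 + mu * v.2) ->
  feasible k m n (t * ((1 - mu) * u.1 + mu * v.1) + 203 * (k * m)%N%:R)
    (t + 203 * (k * m)%N%:R).
Proof.
move=> k0 nm m0 /andP[mu0 mu1] t0 eu ev u0 u1_0 v1 /andP[v1_0 v1_v2] NE.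
have v0 : 0 < v.2 by apply: lt_le_trans v1.
have mR : 0 < m%:R :> R by rewrite ltr0n.
(* On width [x] the pattern [u] uses its share [t (1 - mu)] of the stops; the cut is made at the
   floor [a] of [x]. *)
pose x := t * (1 - mu) * u.2 / m%:R.
have mu1' : 0 <= 1 - mu by rewrite subr_ge0.
have x0 : 0 <= x by rewrite divr_ge0 ?mulr_ge0 ?(ltW t0) ?(ltW u0).
have [a ax xa] : exists2 a : nat, a%:R <= x & x < a.+1%:R.
  by have /andP[] := truncn_itv x0; exists (Num.truncn x).
have nE : n%:R = x + t * mu * v.2 / m%:R.
  by apply: (mulfI (lt0r_neq0 mR)); rewrite -natrM NE /x; field; rewrite gt_eqF.
have xn : x <= n%:R by rewrite nE lerDl divr_ge0 ?mulr_ge0 ?(ltW t0) ?(ltW v0).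
have an : (a <= n)%N by rewrite -(ler_nat R) (le_trans ax).
have am := leq_trans an nm; have bm := leq_trans (leq_subr a n) nm.
have [G [[GD Gcov] sG lG]] := eu 0%N a m am m0.
have [H [[HD Hcov] sH lH]] := ev a (n - a)%N m bm m0.
have DG : all (in_Dint m n) G by apply/allP => p /GD /in_box_Dint; apply.
have DH : all (in_Dint m n) H by apply/allP => p /HD /in_box_Dint; apply; rewrite subnKC.
have au : a%:R * m%:R / u.2 <= t * (1 - mu).
  by rewrite ler_pdivrMr // -ler_pdivlMr.
(* Rounding the cut down widens the right box by less than one unit, at a cost of at most [m / v.2]
   stops. *)
have bv : (n - a)%:R * m%:R / v.2 <= t * mu + m%:R / v.2.
  have -> : t * mu + m%:R / v.2 = (t * mu * v.2 / m%:R + 1) * m%:R / v.2.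
    by field; rewrite !gt_eqF.
  rewrite -!mulrA ler_wpM2r ?divr_ge0 ?(ltW v0) // natrB // nE !mulrA; lra.
have mv : m%:R / v.2 <= m%:R by rewrite ler_pdivrMr // ler_peMr.
have mv1 : v.1 * (m%:R / v.2) <= m%:R.
  by rewrite mulrCA ler_piMr // ler_pdivrMr // mul1r.
have Lu := ler_wpM2l u1_0 au; have Lv := ler_wpM2l v1_0 bv.
have mkm : m%:R <= (k * m)%N%:R :> R by rewrite ler_nat leq_pmull.
have nmR : n%:R <= m%:R :> R by rewrite ler_nat.
exists (undup (G ++ H)); split.
- split; rewrite ?undup_uniq //.
    by apply/allP => p; rewrite mem_undup mem_cat => /orP[/(allP DG)|/(allP DH)].
  move=> p /(in_Dint_boxes an)/orP[/Gcov[q qG pq]|/Hcov[q qH pq]]; exists q => //.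
    by rewrite mem_undup mem_cat qG.
  by rewrite mem_undup mem_cat qH orbT.
- apply: (@le_trans _ _ (size (G ++ H))%:R); first by rewrite ler_nat size_undup.
  by rewrite size_cat natrD; lra.
- have lGH : (path_length (undup (G ++ H)))%:~R <=
      (path_length G)%:~R + (path_length H)%:~R + (m%:R + n%:R) :> R.
    rewrite -natrD -[(m + n)%:R]/((m + n)%N%:Z%:~R) -!intrD ler_int.
    exact: le_trans (path_length_undup _) (path_length_cat_le DG DH).
  apply: (le_trans lGH).
  (* The patterns contribute [200 k m], the rounding at most [m] and the joining leg [m + n], whence
     [203]. *)
  by rewrite !mulrDr in Lu Lv *; lra.
Qed.

Local Open Scope classical_set_scope.

(** * Piecewise-linear functions and polylines *)

Definition abscissa_lt (R : realType) : rel (R * R) := fun u v => u.1 < v.1.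

Lemma pwlinear_vertex (R : realType) (p q : R * R) s :
  path (@abscissa_lt R) p s -> q \in p :: s -> pwlinear p s q.1 = q.2.
Proof.
elim: s p => [|r s IH] p /=; first by rewrite inE => _ /eqP ->.
move=> /andP[pr srt]; rewrite inE => /predU1P[->|qs].
  by rewrite ltW // subrr mulr0 addr0.
have [qr|rq] := lerP q.1 r.1; last exact: IH.
have -> : q = r.
  apply/eqP; move: qs; rewrite inE => /orP[//|qs].
  have tr : transitive (@abscissa_lt R) by move=> ? ? ?; apply: lt_trans.
  have /allP/(_ _ qs) := order_path_min tr srt.
  by rewrite /abscissa_lt ltNge qr.
by rewrite divfK ?subrKC // subr_eq0 gt_eqF.
Qed.

Lemma pwlinear_interpolation (R : realType) (p : R * R) s x :
  path (@abscissa_lt R) p s -> p.1 <= x ->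
  (exists u v mu, [/\ u \in p :: s, v \in p :: s, 0 <= mu <= 1,
     x = (1 - mu) * u.1 + mu * v.1 & pwlinear p s x = (1 - mu) * u.2 + mu * v.2])
  \/ (exists u, [/\ u \in p :: s, u.1 <= x & pwlinear p s x = u.2]).
Proof.
elim: s p => [|r s IH] p /=; first by right; exists p; rewrite mem_head.
move=> /andP[pr srt] px; have [xr|/ltW rx] := lerP x r.1.
  have d0 : 0 < r.1 - p.1 by rewrite subr_gt0.
  left; exists p, r, ((x - p.1) / (r.1 - p.1)); split; rewrite ?mem_head //.
  - by rewrite !inE eqxx orbT.
  - by rewrite divr_ge0 ?(ltW d0) ?subr_ge0 // ler_pdivrMr // mul1r lerD2r.
  - by field; rewrite gt_eqF.
  - by field; rewrite gt_eqF.
have [[u [v [mu [us vs mu01 xE fE]]]]|[u [us ux fE]]] := IH r srt rx.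
  by left; exists u, v, mu; split=> //; rewrite inE ?us ?vs orbT.
by right; exists u; split=> //; rewrite inE us orbT.
Qed.

(** For [f] with [f(u.1) = u.2], this is where the curve [N = t f(L / t)] meets the ray
    [L = u.1 t]. *)
Definition curve_vertex (R : realType) (N : R) (u : R * R) : R * R :=
  (u.1 * N / u.2, N / u.2).

(* On the segment between two vertices, the parameter [tau] of a point [z] and
   the position [mu] of its ratio [z.1 / z.2] between the two abscissae are
   related by [tau N = z.2 mu v.2]. *)
Lemma segment_curve (R : realType) (N : R) (u v z : R * R) :
  0 < N -> 0 < u.1 -> u.1 < v.1 -> 0 < u.2 -> 0 < v.2 ->
  segment (curve_vertex N u) (curve_vertex N v) z <->
  [/\ 0 < z.2, u.1 * z.2 <= z.1, z.1 <= v.1 * z.2 &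
      N = z.2 * (u.2 + (v.2 - u.2) / (v.1 - u.1) * (z.1 / z.2 - u.1))].
Proof.
move=> N0 u1 uv u2 v2; have v1 : 0 < v.1 by apply: lt_trans uv.
have d0 : 0 < v.1 - u.1 by rewrite subr_gt0.
rewrite /segment /curve_vertex /line_path /=; split.
  move=> [tau]; rewrite /= in_itv /= => /andP[t0 t1] <- /=.
  (* With these weights the point is [(a u.1 + b v.1, a + b)] and [N = a u.2 + b v.2], so everything
     becomes linear in [a] and [b]. *)
  set a := (1 - tau) * (N / u.2); set b := tau * (N / v.2).
  have a0 : 0 <= a by rewrite mulr_ge0 ?subr_ge0 // divr_ge0 // ltW.
  have b0 : 0 <= b by rewrite mulr_ge0 // divr_ge0 // ltW.
  have -> : (1 - tau) * (u.1 * N / u.2) + tau * (v.1 * N / v.2) = a * u.1 + b * v.1.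
    by rewrite /a /b; ring.
  have NE : N = a * u.2 + b * v.2 by rewrite /a /b; field; rewrite !gt_eqF.
  have ab0 : 0 < a + b.
    rewrite lt0r addr_ge0 // andbT; apply/eqP => ab.
    have [a00 b00] : a = 0 /\ b = 0 by split; lra.
    by move: N0; rewrite NE a00 b00 !mul0r addr0 ltxx.
  split=> //.
  - by rewrite mulrDr [_ * a]mulrC lerD2l [_ * b]mulrC ler_wpM2l // ltW.
  - by rewrite mulrDr [_ * b]mulrC lerD2r [_ * a]mulrC ler_wpM2l // ltW.
  - by rewrite {1}NE; field; rewrite !gt_eqF.
case: z => L t [/= t0 uL Lv NE].
pose mu := (L / t - u.1) / (v.1 - u.1).
have mu01 : 0 <= mu <= 1.
  rewrite divr_ge0 ?subr_ge0 ?ler_pdivlMr //; last exact: ltW.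
  by rewrite ler_pdivrMr // mul1r lerD2r ler_pdivrMr.
have NE' : N = t * ((1 - mu) * u.2 + mu * v.2).
  by rewrite {1}NE /mu; field; rewrite !gt_eqF.
have LE : L = t * ((1 - mu) * u.1 + mu * v.1) by rewrite /mu; field; rewrite !gt_eqF.
move: mu mu01 NE' LE => mu /andP[mu0 mu1] NE' LE.
have tau1 : 1 - t * mu * v.2 / N = t * (1 - mu) * u.2 / N.
  rewrite -[1 in LHS](@mulfV _ N) ?gt_eqF // -mulrBl; congr (_ / _).
  by rewrite {1}NE'; ring.
exists (t * mu * v.2 / N) => /=.
  rewrite in_itv /= divr_ge0 ?mulr_ge0 ?(ltW t0) ?(ltW N0) ?(ltW v2) //=.
  by rewrite -subr_ge0 tau1 divr_ge0 ?mulr_ge0 ?(ltW t0) ?(ltW N0) ?(ltW u2) ?subr_ge0.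
rewrite tau1; congr (_, _).
  by rewrite [RHS]LE; field; rewrite !gt_eqF.
by field; rewrite !gt_eqF.
Qed.

(** The rays [z.1 = q.1 * z.2] through the vertices cut the plane into cones. On each of them one
    affine piece is active and [segment_curve] applies; on the last one the function is constant,
    which fixes [z.2]. *)
Lemma pwlinear_curve (R : realType) (N : R) (p : R * R) s :
  0 < N -> 0 < p.1 -> path (@abscissa_lt R) p s -> (forall u, u \in p :: s -> 0 < u.2) ->
  [set z | [/\ 0 < z.2, p.1 * z.2 <= z.1 & N = z.2 * pwlinear p s (z.1 / z.2)]] =
  polyline_to_infty (curve_vertex N p) [seq curve_vertex N u | u <- s].
Proof.
move=> N0; elim: s p => [|q s IH] p p0 /=.
  move=> _ /(_ p (mem_head _ _)) p2; apply/seteqP; split=> [[L t]|[L t]] /=.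
    by move=> [t0 pL ->]; rewrite mulfK ?gt_eqF // mulrA mulfK ?gt_eqF.
  move=> [+ ->]; rewrite -mulrA => pL; split=> //; first by rewrite divr_gt0.
  by rewrite divfK ?gt_eqF.
move=> /andP[pq srt] pos.
have q0 : 0 < q.1 by apply: lt_trans pq.
have p2 : 0 < p.2 by apply: pos; rewrite mem_head.
have q2 : 0 < q.2 by apply: pos; rewrite !inE eqxx orbT.
have pos' u : u \in q :: s -> 0 < u.2 by move=> us; apply: pos; rewrite inE us orbT.
rewrite -(IH _ q0 srt pos') ; apply/seteqP; split=> z /=.
  move=> [t0 pL]; case: ifPn => [zq NE|].
    by left; apply/segment_curve => //; split=> //; rewrite -ler_pdivrMr.
  rewrite -ltNge => /ltW zq NE; right; split=> //.
  by rewrite -ler_pdivlMr.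
case=> [/segment_curve[]//|[t0 qL NE]].
  by move=> t0 pL Lq NE; split=> //; rewrite ifT // ler_pdivrMr.
split=> //; first by apply: le_trans qL; rewrite ler_pM2r // ltW.
(* On the common ray of two cones [pwlinear] evaluates the left piece, which agrees with the right
   one at the vertex. *)
case: ifPn => // zq; have zE : z.1 / z.2 = q.1.
  by apply/eqP; rewrite eq_le zq ler_pdivlMr.
move: NE; rewrite zE (pwlinear_vertex srt (mem_head _ _)) => ->.
by rewrite divfK ?subrKC // subr_eq0 gt_eqF.
Qed.

(** * The vertices of [fUBD] *)

Lemma turns_increasing k : (0 < k)%N -> path ltn 1 (turns k).
Proof.
have evens j l : path ltn (2 * j)%N
    ([seq (2 * i)%N | i <- iota j.+1 l] ++ [:: (2 * (j + l) + 1)%N]).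
  elim: l j => [|l IH] j; first by rewrite /= addn0 addn1 ltnSn.
  by rewrite /= ltn_pmul2l // ltnSn -[(j + l.+1)%N]addSnnS; exact: (IH j.+1).
by case: k => // k _; exact: (evens 1%N k).
Qed.

Lemma turn_vertices_increasing (R : realType) k : (0 < k)%N ->
  path (@abscissa_lt R) (1, turn_value R k 1) [seq (e%:R, turn_value R k e) | e <- turns k].
Proof.
move=> k0.
apply: (homo_path (f := fun e : nat => (e%:R, turn_value R k e)) _ (turns_increasing k0)).
by move=> i j; rewrite /abscissa_lt /= ltr_nat.
Qed.

(** These inequalities make the vertices positive and provide the conditions [1 <= v.2] and
    [v.1 <= v.2] of [efficient_mixture]. *)
Lemma turn_value_ge (R : realType) k d : (0 < k)%N -> d \in 1%N :: turns k ->
  1 <= d%:R :> R /\ d%:R <= turn_value R k d.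
Proof.
move=> k0 /(mem_turns k0)[->|[i /andP[i0 ik] ->]|->].
- by rewrite ler1n /turn_value /= ler_nat addn1.
- by rewrite turn_value_even // -natrM !(ler1n, ler_nat); split; nia.
- by rewrite turn_value_last // !(ler1n, ler_nat) /ball_card; split; nia.
Qed.

Lemma fUBD_turn (R : realType) k d : (0 < k)%N -> d \in 1%N :: turns k ->
  fUBD k (d%:R : R) = turn_value R k d.
Proof.
move=> k0 dk; apply: (pwlinear_vertex (q := (d%:R, _)) (turn_vertices_increasing R k0)).
exact: (map_f (fun e : nat => (e%:R : R, turn_value R k e)) dk).
Qed.

Lemma feasible_le (R : realType) k m n (L T L' T' : R) :
  feasible k m n L T -> L <= L' -> T <= T' -> feasible k m n L' T'.
Proof.
move=> [F [cF sF lF]] LL' TT'.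
by exists F; split=> //; [exact: le_trans TT'|exact: le_trans LL'].
Qed.

Theorem theorem8 (R : realType) :
  (exists c1 c2 : R, forall k m n : nat,
     (1 <= k)%N -> (1 <= n)%N -> (n <= m)%N ->
     forall L T : R, 1 < T -> T - 1 <= L ->
       (m * n)%N%:R = (T - 1) * fUBD k (L / (T - 1)) ->
       exists L' T' : R,
         [/\ feasible k m n L' T', `|L - L'| <= c1 * (k * m)%N%:R
           & `|T - T'| <= c2 * (k * m)%N%:R])
  /\
  (forall k m n : nat,
     (1 <= k)%N -> (1 <= n)%N -> (n <= m)%N ->
     UBD_curve R k m n =
       polyline_to_infty (UBD_vertex R k m n 1)
                         [seq UBD_vertex R k m n d | d <- turns k]).
Proof.
split; last first.
  move=> k m n k0 n0 nm.
  have N0 : 0 < (m * n)%N%:R :> R by rewrite ltr0n muln_gt0 n0 (leq_trans n0 nm).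
  have pos (u : R * R) : u \in (1, turn_value R k 1) ::
      [seq (e%:R, turn_value R k e) | e <- turns k] ->
      0 < u.2.
    rewrite -[_ :: _]/[seq (e%:R, turn_value R k e) | e <- 1%N :: turns k].
    move=> /mapP[d /(turn_value_ge R k0)[d1 df] ->] /=.
    exact: lt_le_trans (le_trans d1 df).
  have vertexE d : d \in 1%N :: turns k ->
      UBD_vertex R k m n d = curve_vertex (m * n)%N%:R (d%:R, turn_value R k d).
    by move=> dk; rewrite /UBD_vertex fUBD_turn.
  have -> : [seq UBD_vertex R k m n d | d <- turns k] =
      [seq curve_vertex (m * n)%N%:R u | u <- [seq (e%:R, turn_value R k e) | e <- turns k]].
    by rewrite -map_comp; apply/eq_in_map => d dk /=; apply: vertexE; rewrite inE dk orbT.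
  rewrite vertexE ?mem_head // -(pwlinear_curve N0 _ (turn_vertices_increasing R k0) pos) //.
  apply/seteqP; split=> [_ [L [T [T1 TL NE ->]]]|[L t] /= [t0 tL NE]].
    by rewrite /= subr_gt0 mul1r.
  by exists L, (t + 1); rewrite addrK ltrDr; split=> //; rewrite mul1r in tL.
exists 300; exists 300 => k m n k0 n0 nm L T T1 TL NE.
set t := T - 1 in TL NE; have t0 : 0 < t by rewrite subr_gt0.
have m0 : (0 < m)%N := leq_trans n0 nm.
set c := (k * m)%N%:R; have c1 : 1 <= c by rewrite ler1n muln_gt0 k0.
(* Both budgets are enlarged by the error of [efficient_mixture]; passing from [t] to [T] only adds
   a stop. *)
exists (L + 203 * c), (T + 203 * c).
suff feas : feasible k m n (L + 203 * c) (t + 203 * c).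
  split; first by apply: feasible_le feas _ _; rewrite // lerD2r gerBl.
    by rewrite opprD addNKr normrN ger0_norm; lra.
  by rewrite opprD addNKr normrN ger0_norm; lra.
have good (u : R * R) : u \in (1, turn_value R k 1) ::
      [seq (e%:R, turn_value R k e) | e <- turns k] ->
    [/\ efficient k u, 1 <= u.1 & u.1 <= u.2].
  rewrite -[_ :: _]/[seq (e%:R, turn_value R k e) | e <- 1%N :: turns k].
  move=> /mapP[d dk ->]; have [] := turn_value_ge R k0 dk.
  by split=> //; exact: turn_efficient.
have Lt1 : 1 <= L / t by rewrite ler_pdivlMr // mul1r.
have [[u [v [mu [/good[eu u1 u12] /good[ev v1 v12] mu01 LE fE]]]]|[u [/good[eu u1 u12] uL fE]]] :=
  pwlinear_interpolation (turn_vertices_increasing R k0) Lt1.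
  have -> : L = t * ((1 - mu) * u.1 + mu * v.1) by rewrite -LE mulrC divfK ?gt_eqF.
  apply: efficient_mixture => //; try lra.
  by rewrite NE /fUBD fE.
(* Where [fUBD] is constant, pattern [u] alone is used, as a degenerate mixture; its main length
   [t u.1] is at most [L]. *)
apply: (@feasible_le _ _ _ _ (t * ((1 - 0) * u.1 + 0 * u.1) + 203 * c) (t + 203 * c)) => //.
  apply: efficient_mixture => //; try lra.
  by rewrite NE /fUBD fE; ring.
by rewrite lerD2r subr0 mul1r mul0r addr0 mulrC -ler_pdivlMr.
Qed.
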